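(* Let $n\in\mathbb{N}$ and let $u$ be a formal variable. Define $h(x;u)=\sum_{j=0}^{\lfloor n/2\rfloor}u^jx^j(1+x)^{n-2j}$ and let $h_i\in\mathbb{Z}[u]$ be the coefficient of $x^i$ in $h(x;u)$, i.e. $h_i=\sum_{j=0}^{\min(i,\lfloor n/2\rfloor)}\binom{n-2j}{i-j}u^j$ (this is the symmetric polynomial with center $n/2$ whose $\gamma$-polynomial is $\sum_{j=0}^{\lfloor n/2\rfloor}u^jx^j$). Then for every $1\le i\le\lfloor n/2\rfloor$ and every integer $r\ge 0$, the coefficient of $u^r$ in $h_i^2-h_{i-1}h_{i+1}$ is nonnegative.
   Context: Binomial coefficients $\binom{a}{b}$ with integer $a\ge 0$ are taken to be $0$ unless $0\le b\le a$. *)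

(* Defs.v *)
From mathcomp Require Import all_boot all_order all_algebra.

Set Implicit Arguments.
Unset Strict Implicit.
Unset Printing Implicit Defensive.

Import Order.TTheory GRing.Theory Num.Theory.

Local Open Scope ring_scope.

(* Elements of Z[u][x]: the inner 'X is u, the outer 'X is x. *)
Definition hpoly (n : nat) : {poly {poly int}} :=
  \sum_(j < n./2.+1) ('X^j)%:P * 'X^j * (1 + 'X) ^+ (n - j.*2).

Definition hcoef (n i : nat) : {poly int} := (hpoly n)`_i.

Lemma hcoefE (n i : nat) :
  hcoef n i =
  \sum_(j < (minn i n./2).+1) 'X^j *+ 'C(n - j.*2, i - j).
Proof.
have coefB m k : ((1 + 'X) ^+ m : {poly {poly int}})`_k = 'C(m, k)%:R.
  rewrite exprDn coef_sum.
  under eq_bigr => a _ do rewrite expr1n mul1r coefMn coefXn.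
  case: (ltnP k m.+1) => [lt_km|lt_mk].
    rewrite (bigD1 (Ordinal lt_km)) //= eqxx big1 ?addr0 // => a ne_ak.
    by rewrite eq_sym -[k]/(val (Ordinal lt_km)) (inj_eq val_inj) (negPf ne_ak) mul0rn.
  rewrite bin_small // big1 // => a _.
  by rewrite gtn_eqF ?mul0rn // (leq_trans (ltn_ord a)).
rewrite /hcoef /hpoly coef_sum.
rewrite (big_ord_widen _ (fun j => 'X^j *+ 'C(n - j.*2, i - j))
           (_ : (minn i n./2).+1 <= n./2.+1)%N) ?ltnS ?geq_minr //.
rewrite [RHS]big_mkcond; apply: eq_bigr => j _ /=.
rewrite -mulrA coefCM mulrC coefXnM ltnS leq_min -(ltnS j n./2) ltn_ord andbT.
by rewrite ltnNge; case: leqP; rewrite ?mul0r // coefB mulr_natl.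
Qed.

(* Main.v *)
(* Put c = n - 2i and b_a(s) = 'C(a + 2s, s). When c >= 2 the coefficients of
   u^j in h_(i-1), h_i, h_(i+1) are b_(c+2)(i-1-j), b_c(i-j), b_(c-2)(i+1-j), so
   twice the coefficient of u^r in h_i^2 - h_(i-1) h_(i+1) is the sum of
     T(p, q) = 2 b_c(p) b_c(q) - b_(c+2)(p-1) b_(c-2)(q+1)
                               - b_(c-2)(p+1) b_(c+2)(q-1)
   over the pairs (i-j, i-r+j), 0 <= j <= r: a window centred on the diagonal
   of the line p + q = 2i - r. Over the whole line T sums to 0, since by
   Pascal's rule the convolution of b_a and b_d depends on a + d only. Moreover
   T changes sign at most once, from positive to negative, as |p - q| grows.
   So either T >= 0 on the window, or T <= 0 outside of it, and the sum over the
   window is nonnegative in both cases. When c <= 1, h_(i+1) is h_(i-1) or h_i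
   by symmetry and the claim follows from h_(i-1) <= h_i coefficientwise. *)

Require Import Defs.
From mathcomp Require Import all_boot all_order all_algebra.
From mathcomp Require Import zify ring.

Set Implicit Arguments.
Unset Strict Implicit.
Unset Printing Implicit Defensive.

Import Order.TTheory GRing.Theory Num.Theory.

Local Open Scope ring_scope.

(** This is [b_a], extended by 0 to negative arguments so that sums along a line [p + q] = const
    need no boundary terms. *)
Definition cbin (a : nat) (z : int) : int :=
  if z is Posz s then 'C(a + s.*2, s)%:Z else 0.

Lemma cbin_ge0 a z : 0 <= cbin a z.
Proof. by case: z. Qed.

Lemma cbin_neg a z : z < 0 -> cbin a z = 0.
Proof. by case: z. Qed.

Lemma cbinS a z : cbin a.+1 z = cbin a z + cbin a.+2 (z - 1).
Proof.
case: z => [[|s]|s] //; first by rewrite /= !bin0.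
rewrite (_ : s.+1%:Z - 1 = s%:Z) /=; last lia.
by rewrite -PoszD addSn binS; congr (Posz (_ + 'C(_, _))); lia.
Qed.

Lemma cbin_pred c z :
  0 <= z -> (c%:Z + z + 1) * cbin c.+2 (z - 1) = z * cbin c z.
Proof.
case: z => [[|s]|s] // _; first by rewrite mulr0 mul0r.
rewrite (_ : s.+1%:Z - 1 = s%:Z) /=; last lia.
rewrite -!PoszD -!PoszM (_ : c.+2 + s.*2 = c + s.+1.*2)%N; last lia.
by rewrite mul_bin_left; congr (Posz (_ * _)); lia.
Qed.

Lemma cbin_succ c z :
  0 <= z -> (z + 1) * cbin c (z + 1) = (c.+2%:Z + z) * cbin c.+2 z.
Proof.
case: z => [s|s] // _.
rewrite (_ : s%:Z + 1 = s.+1%:Z) /=; last lia.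
rewrite -!PoszD -!PoszM (_ : c + s.+1.*2 = c.+2 + s.*2)%N; last lia.
by rewrite mul_bin_left; congr (Posz (_ * _)); lia.
Qed.

(** If [y <= 0] and [x < m], every term outside the range of [j] vanishes, so this is the full
    convolution at [x + y]. *)
Definition cconv (m a d : nat) (x y : int) : int :=
  \sum_(j < m) cbin a (x - j%:Z) * cbin d (y + j%:Z).

Lemma cconv_shift m a d x y :
  y <= 0 -> x < m%:Z -> cconv m a d (x - 1) y = cconv m a d x (y - 1).
Proof.
move=> y_le0 x_lt; apply/eqP; rewrite -subr_eq0 -sumrB; apply/eqP.
pose f j := cbin a (x - j%:Z) * cbin d (y - 1 + j%:Z).
rewrite -(big_mkord xpredT (fun j => cbin a (x - 1 - j%:Z) * cbin d (y + j%:Z) - f j)).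
rewrite (eq_bigr (fun j => f j.+1 - f j)) => [|j _]; last first.
  by congr (cbin _ _ * cbin _ _ - _); lia.
rewrite telescope_sumr // /f.
rewrite (@cbin_neg _ (x - m%:Z)); last lia.
by rewrite (@cbin_neg _ (y - 1 + 0%:Z)) ?mulr0 ?mul0r //; lia.
Qed.

(** After Pascal's rule on both sides, what remains are convolutions for [(a.+2, d)] and [(a, d.+2)]
    at [x + y - 1]; induction on a bound for [x + y] equates them through [(a.+1, d.+1)]. *)
Lemma cconv_move m a d x y :
  y <= 0 -> x < m%:Z -> cconv m a.+1 d x y = cconv m a d.+1 x y.
Proof.
have [k] : exists k : nat, x + y < k%:Z by exists `|x + y|.+1; lia.
elim: k => [|k IHk] in a d x y * => lt_xyk y_le0 x_lt.
  have conv0 b c : cconv m b c x y = 0.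
    rewrite /cconv big1 // => j _.
    have [lt0|ge0] := ltP (x - j%:Z) 0; first by rewrite cbin_neg ?mul0r.
    by rewrite (@cbin_neg c) ?mulr0 //; lia.
  by rewrite !conv0.
have -> : cconv m a.+1 d x y = cconv m a d x y + cconv m a.+2 d (x - 1) y.
  rewrite -big_split; apply: eq_bigr => j _ /=.
  by rewrite cbinS mulrDl; congr (_ + cbin _ _ * _); rewrite addrAC.
have -> : cconv m a d.+1 x y = cconv m a d x y + cconv m a d.+2 x (y - 1).
  rewrite -big_split; apply: eq_bigr => j _ /=.
  by rewrite cbinS mulrDr; congr (_ + _ * cbin _ _); rewrite addrAC.
rewrite IHk ?cconv_shift //; [|lia|lia].
by rewrite IHk ?cconv_shift //; lia.
Qed.

(* This is T(p, q), with [c = e.+2]. *)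
Definition defect (e : nat) (p q : int) : int :=
  cbin e.+2 p * cbin e.+2 q *+ 2
  - cbin e.+4 (p - 1) * cbin e (q + 1) - cbin e (p + 1) * cbin e.+4 (q - 1).

Lemma defect_le0_neg e p q : (p < 0) || (q < 0) -> defect e p q <= 0.
Proof.
have le0 u v : 0 <= cbin e u * cbin e.+4 v by rewrite mulr_ge0 ?cbin_ge0.
rewrite /defect => /orP[] lt0.
  rewrite (@cbin_neg _ p) // (@cbin_neg _ (p - 1)); last lia.
  by rewrite !mul0r mul0rn subr0 sub0r oppr_le0.
rewrite (@cbin_neg _ q) // (@cbin_neg _ (q - 1)); last lia.
by rewrite !mulr0 mul0rn subr0 sub0r oppr_le0 mulrC.
Qed.

(* Multiplying [- defect] by its denominators makes it a multiple of this
   quantity (see [defectE]), which is linear in [(p - q) ^+ 2] with positive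
   slope once [p + q] is fixed. *)
Definition defect_sign (e : nat) (p q : int) : int :=
  let w := e.+2%:Z + (p + q) + 1 in
  e.+2%:Z ^+ 2 * (p - q) ^+ 2 - w * (e.+2%:Z * (p + q) + p * q *+ 2)
  - w ^+ 2 *+ 2.

Lemma defectE e p q : 0 <= p -> 0 <= q ->
  (p + 1) * (e.+2%:Z + p + 1) * (q + 1) * (e.+2%:Z + q + 1) * defect e p q
  = - defect_sign e p q * (cbin e.+2 p * cbin e.+2 q).
Proof.
move=> p_ge0 q_ge0.
have p1 := @cbin_pred e.+2 p p_ge0; have q1 := @cbin_pred e.+2 q q_ge0.
have p2 := @cbin_succ e p p_ge0; have q2 := @cbin_succ e q q_ge0.
rewrite /defect /defect_sign.
move: (cbin e.+2 p) (cbin e.+2 q) (cbin e.+4 (p - 1)) (cbin e.+4 (q - 1))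
  (cbin e (p + 1)) (cbin e (q + 1)) (e.+2%:Z) p1 q1 p2 q2 => P Q P1 Q1 P2 Q2 c p1 q1 p2 q2.
(* Each shifted binomial is grouped with the denominator of its ratio to [P] or [Q]. *)
transitivity ((p + 1) * (c + p + 1) * (q + 1) * (c + q + 1) * (P * Q *+ 2)
  - (p + 1) * (c + q + 1) * ((c + p + 1) * P1) * ((q + 1) * Q2)
  - (c + p + 1) * (q + 1) * ((p + 1) * P2) * ((c + q + 1) * Q1)); first ring.
by rewrite p1 q1 p2 q2; ring.
Qed.

Lemma defect_sign_mono e p q p' q' :
  p' + q' = p + q -> (p - q) ^+ 2 <= (p' - q') ^+ 2 -> 0 <= p + q ->
  defect_sign e p q <= defect_sign e p' q'.
Proof.
move=> eq_s le_d s_ge0; rewrite /defect_sign eq_s.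
set w := _ + 1; have w_ge0 : 0 <= w by rewrite /w; lia.
(* As 4pq = (p + q)^2 - (p - q)^2, this is twice the difference of the two sides. *)
have : 0 <= (e.+2%:Z ^+ 2 *+ 2 + w) * ((p' - q') ^+ 2 - (p - q) ^+ 2).
  by rewrite mulr_ge0 ?subr_ge0 // addr_ge0 // mulrn_wge0 ?sqr_ge0.
have -> : q' = p + q - p' by lia.
lia.
Qed.

Lemma defect_sign_change e p q p' q' :
  p' + q' = p + q -> (p - q) ^+ 2 <= (p' - q') ^+ 2 ->
  defect e p q < 0 -> defect e p' q' <= 0.
Proof.
move=> eq_s le_d lt0.
have [?|p'_ge0] := ltP p' 0; first by apply: defect_le0_neg; apply/orP; left.
have [?|q'_ge0] := ltP q' 0; first by apply: defect_le0_neg; apply/orP; right.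
(* Indeed |p - q| <= |p' - q'| <= p' + q' = p + q. *)
have [p_ge0 q_ge0] : 0 <= p /\ 0 <= q by split; nia.
have gt0 (u v : int) : 0 <= u -> 0 <= v ->
  0 < (u + 1) * (e.+2%:Z + u + 1) * (v + 1) * (e.+2%:Z + v + 1).
  by move=> ? ?; rewrite !mulr_gt0 //; lia.
have s_gt0 : 0 < defect_sign e p q.
  rewrite ltNge; apply/negP => s_le0.
  move: lt0; rewrite -(pmulr_rlt0 _ (gt0 p q p_ge0 q_ge0)) defectE //.
  by rewrite ltNge mulr_ge0 ?oppr_ge0 // mulr_ge0 ?cbin_ge0.
rewrite -(pmulr_rle0 _ (gt0 p' q' p'_ge0 q'_ge0)) defectE //.
rewrite mulNr oppr_le0 mulr_ge0 ?mulr_ge0 ?cbin_ge0 //.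
by apply: le_trans (ltW s_gt0) _; apply: defect_sign_mono => //; lia.
Qed.

Lemma sum_defect m e x y :
  y < 0 -> x + 1 < m%:Z -> \sum_(j < m) defect e (x - j%:Z) (y + j%:Z) = 0.
Proof.
move=> y_lt0 x_lt.
have -> : \sum_(j < m) defect e (x - j%:Z) (y + j%:Z) =
    cconv m e.+2 e.+2 x y *+ 2 - cconv m e.+4 e (x - 1) (y + 1)
    - cconv m e e.+4 (x + 1) (y - 1).
  rewrite -sumrMnl -!sumrB; apply: eq_bigr => j _.
  by rewrite /defect; congr (_ - cbin _ _ * cbin _ _ - cbin _ _ * cbin _ _); lia.
(* Shifting brings all three convolutions to [x], [y]; their indices all add up to 2e + 4, so they
   coincide and cancel. *)
rewrite cconv_shift; [|lia|lia].
rewrite -(@cconv_shift _ _ _ (x + 1)); [|lia|lia].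
have y_le0 : y <= 0 by lia.
have x_ltm : x < m%:Z by lia.
rewrite !addrK -(@cconv_move m e) // -(@cconv_move m e.+1) //.
by rewrite (@cconv_move m e.+3) // (@cconv_move m e.+2) // mulr2n addrK subrr.
Qed.

Lemma sum_defect_ge0 e (i r : nat) :
  0 <= \sum_(j < r.+1) defect e (i%:Z - j%:Z) (i%:Z - r%:Z + j%:Z).
Proof.
have [/forallP ge0|] := boolP [forall j : 'I_r.+1,
    0 <= defect e (i%:Z - j%:Z) (i%:Z - r%:Z + j%:Z)].
  by apply: sumr_ge0 => j _; apply: ge0.
rewrite negb_forall => /existsP[j0]; rewrite -ltNge => lt0.
(* Adding [m] terms on each side of the window covers the whole support on the line. *)
pose m := (i + r).+2.
have := @sum_defect (m + (r.+1 + m)) e (i%:Z + m%:Z) (i%:Z - r%:Z - m%:Z).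
rewrite !big_split_ord /= => total.
have {total} := total _ _.
set A := \sum_(j < m) _; set B := \sum_(j < r.+1) _; set C := \sum_(j < m) _.
move=> total.
have -> : \sum_(j < r.+1) defect e (i%:Z - j%:Z) (i%:Z - r%:Z + j%:Z) = B.
  by apply: eq_bigr => j _; congr (defect _ _ _); lia.
(* Here |p - q| > r, whereas |p - q| <= r at the negative term [j0] of the window. *)
have A_le0 : A <= 0.
  apply: sumr_le0 => j _; apply: defect_sign_change lt0; first lia.
  have := ltn_ord j; have := ltn_ord j0; nia.
have C_le0 : C <= 0.
  apply: sumr_le0 => j _; apply: defect_sign_change lt0; first lia.
  have := ltn_ord j; have := ltn_ord j0; nia.
have : A + (B + C) = 0 by apply: total; rewrite /m; lia.
lia.
Qed.

Lemma coef_hcoef n i j :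
  (hcoef n i)`_j = if (j <= minn i n./2)%N then 'C(n - j.*2, i - j)%:Z else 0.
Proof.
rewrite hcoefE coef_sum.
under eq_bigr => k _ do rewrite coefMn coefXn.
case: leqP => [le_j|lt_j].
  rewrite (bigD1 (inord j)) //= inordK // eqxx big1 ?addr0 ?natz // => k ne_kj.
  case: eqP => [eq_jk|_]; last by rewrite mul0rn.
  by case/eqP: ne_kj; apply: val_inj; rewrite /= inordK.
rewrite big1 // => k _; case: eqP => [eq_jk|_]; last by rewrite mul0rn.
by have := ltn_ord k; lia.
Qed.

Lemma coef_hcoef_cbin n i j :
  (i <= n./2)%N -> (hcoef n i)`_j = cbin (n - i.*2) (i%:Z - j%:Z).
Proof.
move=> le_in; rewrite coef_hcoef (minn_idPl le_in); case: leqP => [le_ji|lt_ij].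
  rewrite (_ : i%:Z - j%:Z = (i - j)%N) /=; last lia.
  by congr (Posz 'C(_, _)); lia.
by rewrite cbin_neg //; lia.
Qed.

Lemma coef_hcoef_mono n i j :
  (0 < i <= n./2)%N -> (hcoef n i.-1)`_j <= (hcoef n i)`_j.
Proof.
move=> /andP[i_gt0 le_in]; rewrite !coef_hcoef.
rewrite (minn_idPl le_in) (minn_idPl (leq_trans (leq_pred i) le_in)).
case: (leqP j i.-1) => [le_ji|_]; last by case: ifP.
rewrite (leq_trans le_ji (leq_pred i)) lez_nat.
have [s eq_s] : exists s, (i - j = s.+1)%N by exists (i - j).-1; lia.
rewrite eq_s (_ : i.-1 - j = s)%N; last lia.
(* With N = n - 2j, (s + 1) C(N, s + 1) = (N - s) C(N, s), and s + 1 <= N - s because 2i <= n. *)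
rewrite -(leq_pmul2l (ltn0Sn s)) mul_bin_left leq_mul2r; apply/orP; right; lia.
Qed.

Lemma coefM_ge0 (p q : {poly int}) :
  (forall j, 0 <= p`_j) -> (forall j, 0 <= q`_j) -> forall r, 0 <= (p * q)`_r.
Proof. by move=> p0 q0 r; rewrite coefM sumr_ge0 // => j _; rewrite mulr_ge0. Qed.

Lemma coef_hcoef_ge0 n i j : 0 <= (hcoef n i)`_j.
Proof. by rewrite coef_hcoef; case: ifP. Qed.

Lemma hcoef_double_succ i : (0 < i)%N -> hcoef i.*2 i.+1 = hcoef i.*2 i.-1.
Proof.
move=> i_gt0; apply/polyP => j; rewrite !coef_hcoef doubleK.
rewrite (minn_idPr (leqnSn i)) (minn_idPl (leq_pred i)).
case: (leqP j i) => [le_ji|lt_ij]; last by rewrite ifN //; lia.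
(* The extra index j = i contributes C(0, 1) = 0; the others match by symmetry of binomials. *)
case: (leqP j i.-1) => [le_ji1|lt_ij]; last by rewrite bin_small //; lia.
rewrite -bin_sub; last lia.
by congr (Posz 'C(_, _)); lia.
Qed.

Lemma hcoef_doubleS_succ i : hcoef i.*2.+1 i.+1 = hcoef i.*2.+1 i.
Proof.
apply/polyP => j; rewrite !coef_hcoef (_ : i.*2.+1./2 = i); last lia.
rewrite (minn_idPr (leqnSn i)) minnn; case: leqP => // le_ji.
rewrite -bin_sub; last lia.
by congr (Posz 'C(_, _)); lia.
Qed.

Theorem theorem4p2 (n i r : nat) (hi1 : (1 <= i)%N) (hi2 : (i <= n./2)%N) :
  0 <= (hcoef n i ^+ 2 - hcoef n i.-1 * hcoef n i.+1)`_r.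
Proof.
have diff_ge0 j : 0 <= (hcoef n i - hcoef n i.-1)`_j.
  by rewrite coefB subr_ge0 coef_hcoef_mono ?hi1.
have [n_even|n_odd|[e def_e]] : [\/ n = i.*2, n = i.*2.+1 |
    exists e, n - i.*2 = e.+2]%N.
- have [?|?] := leqP n i.*2; first by constructor 1; lia.
  have [?|?] := leqP n i.*2.+1; first by constructor 2; lia.
  by constructor 3; exists (n - i.*2 - 2)%N; lia.
- have -> : hcoef n i.+1 = hcoef n i.-1 by rewrite n_even hcoef_double_succ.
  rewrite -expr2 subr_sqr; apply: coefM_ge0 => // j.
  by rewrite coefD addr_ge0 ?coef_hcoef_ge0.
- have -> : hcoef n i.+1 = hcoef n i by rewrite n_odd hcoef_doubleS_succ.
  rewrite expr2 -mulrBl.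
  by apply: coefM_ge0 => // j; apply: coef_hcoef_ge0.
rewrite -(pmulrn_lge0 _ (ltn0Sn 1)).
suff -> : (hcoef n i ^+ 2 - hcoef n i.-1 * hcoef n i.+1)`_r *+ 2 =
    \sum_(j < r.+1) defect e (i%:Z - j%:Z) (i%:Z - r%:Z + j%:Z).
  exact: sum_defect_ge0.
(* Commuting one of the two copies of the product yields both mixed terms of [defect]. *)
rewrite coefB mulrnBl expr2 [X in _ - X]mulr2n {2}[hcoef n i.-1 * _]mulrC !coefM opprD addrA.
rewrite -sumrMnl -!sumrB; apply: eq_bigr => j _.
have := ltn_ord j; rewrite ltnS => le_jr.
have le_pred : (i.-1 <= n./2)%N by lia.
have le_succ : (i.+1 <= n./2)%N by lia.
have def_pred : (n - i.-1.*2 = e.+4)%N by lia.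
have def_succ : (n - i.+1.*2 = e)%N by lia.
rewrite !coef_hcoef_cbin // def_e def_pred def_succ /defect.
by congr (_ * cbin _ _ *+ 2 - cbin _ _ * cbin _ _ - cbin _ _ * cbin _ _); lia.
Qed.
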